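(* Let $\Pi$ be a translation-invariant ergodic point process on $\mathbb{R}^d$ of finite, positive intensity, and let $\Pi^*$ be its Palm version. The following are equivalent. (i) $\Pi$ is insertion-tolerant. (ii) $\Pi+\delta_0\prec\Pi^*$.
   Context: Point processes are always simple and locally finite, i.e. random elements of the space $\mathbb{M}$ of simple locally finite point measures on $\mathbb{R}^d$, equipped with the $\sigma$-field $\mathfrak{M}$ generated by the evaluations $\mu\mapsto\mu(A)$, $A$ Borel. The support of $\mu\in\mathbb{M}$ is $[\mu]=\{y:\mu(\{y\})=1\}$. A point process is translation-invariant if its law is invariant under all translations of $\mathbb{R}^d$, and ergodic if moreover every translation-invariant event in $\mathfrak{M}$ has probability $0$ or $1$. The intensity of a translation-invariant $\Pi$ is $\lambda=\mathbb{E}\,\Pi([0,1]^d)$. For random variables $X,Y$ with values in the same measurable space, $X\prec Y$ means that $\mathbb{P}(Y\in\mathcal{A})=0$ implies $\mathbb{P}(X\in\mathcal{A})=0$ for all measurable $\mathcal{A}$. For $x\in\mathbb{R}^d$, $\delta_x$ is the point measure at $x$. $\Pi$ is insertion-tolerant if for every Borel set $S\subseteq\mathbb{R}^d$ with Lebesgue measure in $(0,\infty)$, if $U$ is uniformly distributed on $S$ and independent of $\Pi$, then $\Pi+\delta_U\prec\Pi$. For $x\in\mathbb{R}^d$ let $\theta_x$ be the translation $y\mapsto y+x$, acting on measures by $(\theta_x\mu)(S)=\mu(\theta_x^{-1}S)$ and on sets of measures by $\theta_x\mathcal{A}=\{\theta_x\mu:\mu\in\mathcal{A}\}$. The Palm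 version of $\Pi$ (of intensity $\lambda\in(0,\infty)$) is the point process $\Pi^*$ such that for all $\mathcal{A}\in\mathfrak{M}$ and all Borel $S$ of finite Lebesgue measure $\mathcal{L}(S)$, $$\mathbb{E}\,\#\{x\in[\Pi]\cap S:\ \Pi\in\theta_x\mathcal{A}\}=\lambda\,\mathcal{L}(S)\,\mathbb{P}(\Pi^*\in\mathcal{A}).$$ *)

(* Defs.v *)
From HB Require Import structures.
From mathcomp Require Import all_boot all_order all_algebra finmap.
From mathcomp Require Import all_classical all_reals all_analysis measurable_realfun.

Set Implicit Arguments.
Unset Strict Implicit.
Unset Printing Implicit Defensive.

Import Order.TTheory GRing.Theory Num.Theory.
Import numFieldNormedType.Exports.

Local Open Scope classical_set_scope.
Local Open Scope ring_scope.

Definition borel_rV_display : measure_display. Proof. by constructor. Qed.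

Section borel_rV.
Variables (R : realType) (d : nat).
Local Notation E := 'rV[R]_d.

Definition borel_rV : set (set E) := <<s [set U : set E | open U] >>.

Let borel0 : borel_rV set0. Proof. exact: sigma_algebra0. Qed.
Let borelC A : borel_rV A -> borel_rV (~` A).
Proof. exact: sigma_algebraC. Qed.
Let borelU (F : (set E)^nat) :
  (forall i, borel_rV (F i)) -> borel_rV (\bigcup_i F i).
Proof. exact: sigma_algebra_bigcup. Qed.

HB.instance Definition _ := @isMeasurable.Build borel_rV_display
  'rV[R]_d borel_rV borel0 borelC borelU.

Lemma open_measurable_rV (U : set E) : open U -> measurable U.
Proof. by move=> oU; apply: sub_sigma_algebra. Qed.

Lemma continuous_measurable_rV (f : E -> E) :
  continuous f -> measurable_fun setT f.
Proof.
move=> cf; apply: (measurability [set U : set E | open U]) => //.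
move=> _ [U oU <-]; rewrite setTI; apply: open_measurable_rV.
by move/continuousP : cf; exact.
Qed.

Lemma measurable_add_rV (x : E) : measurable_fun setT (fun y : E => y + x).
Proof.
apply: continuous_measurable_rV => y.
exact: (@cvgD _ E _ (nbhs y) _ id (cst x) y x cvg_id (cvg_cst _)).
Qed.

Definition rat_box (q : 'rV[rat]_d * 'rV[rat]_d) : set E :=
  [set x | forall i, ratr (q.1 0 i) < x 0 i < ratr (q.2 0 i)].

Lemma open_rat_box (U : set E) : open U ->
  U = \bigcup_(q in [set q | rat_box q `<=` U]) rat_box q.
Proof.
rewrite openE => oU; apply/seteqP; split; last by move=> x [q qU /qU].
move=> x /oU; rewrite /interior => /nbhs_ballP[e /= e0 eU].
have /boolp.choice[a xa] : forall i : 'I_d,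
    exists q : rat, ratr q \in `]x 0 i - e, x 0 i[.
  by move=> i; apply: rat_in_itvoo; rewrite ltrBlDr ltrDl.
have /boolp.choice[b xb] : forall i : 'I_d,
    exists q : rat, ratr q \in `]x 0 i, x 0 i + e[.
  by move=> i; apply: rat_in_itvoo; rewrite ltrDl.
exists (\row_i a i, \row_i b i); last first.
  move=> i /=; rewrite !mxE.
  by have := xa i; have := xb i; rewrite !in_itv/= => /andP[-> _] /andP[_ ->].
move=> y yq; apply: eU; split=> // i j; rewrite (ord1 i) /ball /= ltr_norml.
have := yq j; rewrite /= !mxE.
have := xa j; have := xb j; rewrite !in_itv/= => /andP[_ xb2] /andP[xa1 _].
move=> /andP[ya yb]; apply/andP; split.
  by rewrite ltrBrDl ltrBlDr (lt_trans yb).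
by rewrite ltrBlDr -ltrBlDl (lt_trans xa1).
Qed.

Lemma measurable_fun_rV disp (T : measurableType disp) (f : T -> E) :
  (forall i, measurable_fun setT (fun t => f t 0 i)) -> measurable_fun setT f.
Proof.
move=> mf; apply: (measurability [set U : set E | open U]) => //.
move=> _ [U oU <-]; rewrite setTI (open_rat_box oU) preimage_bigcup.
rewrite bigcup_mkcond; apply: countable_bigcupT_measurable => // q.
case: ifP => // _.
have -> : f @^-1` rat_box q = \bigcap_(i in [set: 'I_d])
    ((fun t => f t 0 i) @^-1` `]ratr (q.1 0 i), ratr (q.2 0 i)[).
  apply/seteqP; split => t /=.
    by move=> h i _; rewrite /= in_itv/=; exact: h.
  by move=> h i; have := h i I; rewrite /= in_itv.
apply: fin_bigcap_measurable => // i _.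
by rewrite -[X in measurable X]setTI; apply: mf => //; exact: measurable_itv.
Qed.

End borel_rV.

Section cons_rV.
Variables (R : realType) (d : nat).

Definition cons_rV (p : measurableTypeR R * 'rV[R]_d) : 'rV[R]_d.+1 :=
  \row_i oapp (p.2 0) p.1 (unlift ord0 i).

Lemma continuous_coord_rV (i : 'I_d) : continuous (fun x : 'rV[R]_d => x 0 i).
Proof. exact: coord_continuous. Qed.

Lemma measurable_coord_rV (i : 'I_d) :
  measurable_fun setT (fun x : 'rV[R]_d => x 0 i).
Proof.
apply: (measurability _ (RGenOpens.measurableE R)) => //.
move=> _ [_ [a [b ->]] <-]; rewrite setTI; apply: open_measurable_rV.
have /continuousP := @continuous_coord_rV i; apply.
exact: interval_open.
Qed.

Lemma measurable_cons_rV : measurable_fun setT cons_rV.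
Proof.
apply: measurable_fun_rV => i; rewrite /cons_rV.
under eq_fun do rewrite mxE.
case: (unlift ord0 i) => [j|] /=; last exact: measurable_fst.
exact: measurableT_comp (measurable_coord_rV j) measurable_snd.
Qed.

End cons_rV.

Section lebesgue_succ.
Variables (R : realType) (d : nat).
Variable m : {sigma_finite_measure set 'rV[R]_d -> \bar R}.

Definition lebesgue_succ : set 'rV[R]_d.+1 -> \bar R :=
  pushforward (@lebesgue_measure R \x m)%E (@cons_rV R d).

Let measurable_pre A : measurable A -> measurable (@cons_rV R d @^-1` A).
Proof.
by move=> mA; rewrite -[X in measurable X]setTI; exact: measurable_cons_rV.
Qed.

Let lebesgue_succ0 : lebesgue_succ set0 = 0%E.
Proof. by rewrite /lebesgue_succ /pushforward preimage_set0 measure0. Qed.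

Let lebesgue_succ_ge0 A : (0 <= lebesgue_succ A)%E.
Proof. by rewrite /lebesgue_succ /pushforward measure_ge0. Qed.

Let lebesgue_succ_sigma_additive : semi_sigma_additive lebesgue_succ.
Proof.
move=> F mF tF mUF; rewrite /lebesgue_succ /pushforward preimage_bigcup.
apply: measure_semi_sigma_additive.
- by move=> n; exact: measurable_pre.
- apply/trivIsetP => /= i j _ _ ij; rewrite -preimage_setI.
  by move/trivIsetP : tF => /(_ _ _ _ _ ij) ->//; rewrite preimage_set0.
- by rewrite -preimage_bigcup; exact: measurable_pre.
Qed.

HB.instance Definition _ := isMeasure.Build _ _ _ lebesgue_succ
  lebesgue_succ0 lebesgue_succ_ge0 lebesgue_succ_sigma_additive.

Let head_tail (x : 'rV[R]_d.+1) : measurableTypeR R * 'rV[R]_d :=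
  (x 0 ord0, \row_i x 0 (lift ord0 i)).

Let cons_rVK : cancel (@cons_rV R d) head_tail.
Proof.
move=> [a x]; rewrite /head_tail /cons_rV; congr (_, _).
  by rewrite mxE unlift_none.
by apply/rowP => i; rewrite !mxE liftK.
Qed.

Let measurable_head_tail : measurable_fun setT head_tail.
Proof.
apply: measurable_fun_pair; first exact: measurable_coord_rV.
apply: measurable_fun_rV => i /=.
under eq_fun do rewrite mxE.
exact: measurable_coord_rV.
Qed.

Let lebesgue_succ_sigma_finite : sigma_finite setT lebesgue_succ.
Proof.
have /sigma_finiteP[F [TF ndF Foo]] := sigma_finiteT (@lebesgue_measure R).
have /sigma_finiteP[G [TG ndG Goo]] := sigma_finiteT m.
exists (fun n => head_tail @^-1` (F n `*` G n)).
  rewrite -preimage_bigcup -[LHS](preimage_setT head_tail); congr (_ @^-1` _).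
  rewrite -setXTT TF TG predeqE => -[x y]; split.
    move=> [/= [n _ Fnx] [k _ Gky]]; exists (maxn n k) => //; split.
    - by move: x Fnx; exact/subsetPset/ndF/leq_maxl.
    - by move: y Gky; exact/subsetPset/ndG/leq_maxr.
  by move=> [n _ []/= ? ?]; split; exists n.
move=> n; have [mF Fn] := Foo n; have [mG Gn] := Goo n; split.
  rewrite -[X in measurable X]setTI; apply: measurable_head_tail => //.
  exact: measurableX.
rewrite /lebesgue_succ /pushforward -comp_preimage.
have -> : head_tail \o @cons_rV R d = id by apply/funext => p; exact: cons_rVK.
rewrite preimage_id.
by rewrite product_measure1E// lte_mul_pinfty// ge0_fin_numE.
Qed.

HB.instance Definition _ := @Measure_isSigmaFinite.Build _ _ _ lebesgue_succ
  lebesgue_succ_sigma_finite.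

End lebesgue_succ.

(* d-dimensional Lebesgue measure, as the iterated product of the
   one-dimensional one *)
Fixpoint lebesgue_rV (R : realType) (d : nat) :
    {sigma_finite_measure set 'rV[R]_d -> \bar R} :=
  if d is d'.+1 then lebesgue_succ (lebesgue_rV R d')
  else dirac (0 : 'rV[R]_0).

Section translation.
Variables (R : realType) (d : nat).
Local Notation E := 'rV[R]_d.
Implicit Types (x y : E) (mu : {measure set E -> \bar R}).

Definition translate x y : E := y + x.

Lemma measurable_translate x : measurable_fun setT (translate x).
Proof. exact: measurable_add_rV. Qed.

Lemma translate_inj x : injective (translate x).
Proof. exact: addIr. Qed.

Definition translate_measure x mu : set E -> \bar R :=
  pushforward mu (translate x).

Section translate_measure_is_measure.
Variables (x : E) (mu : {measure set E -> \bar R}).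

Let measurable_pre A : measurable A -> measurable (translate x @^-1` A).
Proof.
by move=> mA; rewrite -[X in measurable X]setTI; exact: measurable_translate.
Qed.

Let translate_measure0 : translate_measure x mu set0 = 0%E.
Proof. by rewrite /translate_measure /pushforward preimage_set0 measure0. Qed.

Let translate_measure_ge0 A : (0 <= translate_measure x mu A)%E.
Proof. by rewrite /translate_measure /pushforward measure_ge0. Qed.

Let translate_measure_sigma_additive :
  semi_sigma_additive (translate_measure x mu).
Proof.
move=> F mF tF mUF; rewrite /translate_measure /pushforward preimage_bigcup.
apply: measure_semi_sigma_additive.
- by move=> n; exact: measurable_pre.
- apply/trivIsetP => /= i j _ _ ij; rewrite -preimage_setI.
  by move/trivIsetP : tF => /(_ _ _ _ _ ij) ->//; rewrite preimage_set0.
- by rewrite -preimage_bigcup; exact: measurable_pre.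
Qed.

HB.instance Definition _ := isMeasure.Build _ _ _ (translate_measure x mu)
  translate_measure0 translate_measure_ge0 translate_measure_sigma_additive.

End translate_measure_is_measure.

(* A sum of unit masses at the (distinct) points of some set D. A library
   measure is a function on all sets, measurable or not; asking for the
   formula on all of them makes two such measures equal as soon as they agree
   on Borel sets. *)
Definition simple_point_measure mu :=
  exists D : set E, forall A : set E, mu A = counting (A `&` D).

Definition locally_finite_measure mu :=
  forall A : set E, bounded_set A -> (mu A < +oo)%E.

End translation.

Lemma counting_image (T : choiceType) (R : realType) (f : T -> T) (A : set T) :
  injective f -> counting (f @` A) = counting A :> \bar R.
Proof.
move=> fI; rewrite /counting; have [fA|nfA] := pselect (finite_set A).
  rewrite !asboolT//; last exact: finite_image.
  by rewrite fset_set_image// card_imfset.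
rewrite !asboolF// => ffA; apply: nfA.
apply: (sub_finite_set _ (finite_preimage _ ffA)); first by move=> x Ax; exists x.
by move=> x y _ _; exact: fI.
Qed.

Section point_measures.
Variables (R : realType) (d : nat).
Local Notation E := 'rV[R]_d.

Record point_measure := PointMeasure {
  measure_of :> {measure set E -> \bar R} ;
  _ : simple_point_measure measure_of ;
  _ : locally_finite_measure measure_of }.

Lemma simple_point_measure0 :
  simple_point_measure (mzero : {measure set E -> \bar R}).
Proof.
by exists set0 => A; rewrite setI0 /counting asboolT// fset_set0.
Qed.

Lemma locally_finite_measure0 :
  locally_finite_measure (mzero : {measure set E -> \bar R}).
Proof. by move=> A _; exact: ltry. Qed.

HB.instance Definition _ := gen_eqMixin point_measure.
HB.instance Definition _ := gen_choiceMixin point_measure.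
HB.instance Definition _ := isPointed.Build point_measure
  (PointMeasure simple_point_measure0 locally_finite_measure0).

(* the sigma-field generated by the evaluations mu |-> mu A, A Borel *)
Definition point_measure_measurable : set (set point_measure) :=
  <<s \bigcup_(A in @measurable _ E)
        preimage_set_system setT (fun mu : point_measure => mu A) measurable >>.

Let pmm0 : point_measure_measurable set0.
Proof. exact: sigma_algebra0. Qed.
Let pmmC A : point_measure_measurable A -> point_measure_measurable (~` A).
Proof. exact: sigma_algebraC. Qed.
Let pmmU (F : (set point_measure)^nat) :
  (forall i, point_measure_measurable (F i)) ->
  point_measure_measurable (\bigcup_i F i).
Proof. exact: sigma_algebra_bigcup. Qed.

Definition point_measure_display : measure_display.
Proof. by constructor. Qed.

HB.instance Definition _ := @isMeasurable.Build point_measure_display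
  point_measure point_measure_measurable pmm0 pmmC pmmU.

Definition support (mu : point_measure) : set E :=
  [set y | mu [set y] = 1%E].

Lemma simple_translate (x : E) (mu : point_measure) :
  simple_point_measure (translate_measure x mu).
Proof.
case: mu => mu /= [D muD] _; exists (translate x @` D) => A.
transitivity (counting (translate x @^-1` A `&` D) : \bar R).
  exact: muD.
rewrite -(counting_image _ _ (@translate_inj _ _ x)).
congr counting; apply/seteqP; split => [_ [y [Ay Dy] <-]|z [Az [y Dy yz]]].
  by split=> //; exists y.
by exists y => //; split=> //; rewrite /preimage /= yz.
Qed.

Lemma locally_finite_translate (x : E) (mu : point_measure) :
  locally_finite_measure (translate_measure x mu).
Proof.
case: mu => mu /= _ lf A bA; apply: lf.
case: bA => M [Mr MA]; exists (M + `|x|); split; first by rewrite realD.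
move=> N MN y Ay; have /= := MA (N - `|x|).
rewrite ltrBrDr => /(_ MN _ Ay); rewrite /translate => yxN.
by rewrite -(addrK x y) (le_trans (ler_normB _ _))// -lerBrDr.
Qed.

(* theta_x acting on point measures *)
Definition theta (x : E) (mu : point_measure) : point_measure :=
  PointMeasure (simple_translate x mu) (locally_finite_translate x mu).

End point_measures.

Section point_processes.
Variables (R : realType) (d : nat).
Local Notation E := 'rV[R]_d.
Local Notation M := (point_measure R d).
Local Open Scope ereal_scope.

(* X \prec Y. Here X is a random function on the subsets of R^d, and the event
   "X \in A" is stated for measurable sets A of simple point measures only.
   This lets X be a sum Pi + \d_U, which leaves the space of simple measures
   on the null event that U hits an atom of Pi. *)
Definition prec d1 (T1 : measurableType d1) (P1 : probability T1 R)
    (X : T1 -> set E -> \bar R)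
    d2 (T2 : measurableType d2) (P2 : probability T2 R) (Y : {RV P2 >-> M}) :=
  forall A : set M, measurable A ->
    P2 [set w | A (Y w)] = 0 ->
    P1 [set w | exists2 mu : M, A mu & X w = mu] = 0.

Section process.
Context d1 (T : measurableType d1) (P : probability T R).
Variable Pi : {RV P >-> M}.

Definition translation_invariant :=
  forall (x : E) (A : set M), measurable A ->
    P [set w | A (theta x (Pi w))] = P [set w | A (Pi w)].

Definition ergodic :=
  translation_invariant /\
  forall A : set M, measurable A -> (forall x : E, theta x @` A = A) ->
    P [set w | A (Pi w)] = 0 \/ P [set w | A (Pi w)] = 1.

Definition intensity : \bar R :=
  \int[P]_w Pi w [set x : E | forall i, (0 <= x 0%R i <= 1)%R].

Definition add_point (U : T -> E) : T -> set E -> \bar R :=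
  fun w B => Pi w B + \d_(U w) B.

End process.

Definition uniform_on d1 (T : measurableType d1) (P : probability T R)
    (U : {RV P >-> E}) (S : set E) :=
  forall B : set E, measurable B ->
    P [set w | B (U w)] =
      lebesgue_rV R d (B `&` S) * ((fine (lebesgue_rV R d S))^-1)%:E.

Definition independent_RV d1 (T : measurableType d1) (P : probability T R)
    d2 (V : measurableType d2) d3 (W : measurableType d3)
    (X : {RV P >-> V}) (Y : {RV P >-> W}) :=
  forall (A : set V) (B : set W), measurable A -> measurable B ->
    P [set w | A (X w) /\ B (Y w)] = P [set w | A (X w)] * P [set w | B (Y w)].

Definition same_law d1 (T1 : measurableType d1) (P1 : probability T1 R)
    d2 (T2 : measurableType d2) (P2 : probability T2 R)
    d3 (V : measurableType d3) (X : {RV P1 >-> V}) (Y : {RV P2 >-> V}) :=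
  forall A : set V, measurable A ->
    P1 [set w | A (X w)] = P2 [set w | A (Y w)].

(* The probability space of Pi need not carry a uniform variable independent
   of Pi, so U lives on any space that also carries a copy Pi' of Pi. *)
Definition insertion_tolerant d1 (T : measurableType d1)
    (P : probability T R) (Pi : {RV P >-> M}) :=
  forall S : set E, measurable S ->
    0 < lebesgue_rV R d S -> lebesgue_rV R d S < +oo ->
  forall (d2 : measure_display) (T' : measurableType d2)
    (P' : probability T' R) (Pi' : {RV P' >-> M}) (U : {RV P' >-> E}),
    same_law Pi' Pi -> uniform_on U S -> independent_RV Pi' U ->
    prec P' (add_point Pi' U) Pi.

Definition palm_version d1 (T1 : measurableType d1) (P1 : probability T1 R)
    (Pi : {RV P1 >-> M})
    d2 (T2 : measurableType d2) (P2 : probability T2 R)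
    (PiS : {RV P2 >-> M}) :=
  forall (A : set M) (S : set E), measurable A -> measurable S ->
    lebesgue_rV R d S < +oo ->
    \int[P1]_w counting
        [set x | (support (Pi w) `&` S) x /\ (theta x @` A) (Pi w)] =
    intensity Pi * lebesgue_rV R d S * P2 [set w | A (PiS w)].

End point_processes.

(* Main.v *)
From HB Require Import structures.
Require Import Defs.
From mathcomp Require Import all_boot all_order all_algebra finmap.
From mathcomp Require Import all_classical all_reals all_analysis measurable_realfun.

Set Implicit Arguments.
Unset Strict Implicit.
Unset Printing Implicit Defensive.

Import Order.TTheory GRing.Theory Num.Theory.
Import numFieldNormedType.Exports.

Local Open Scope classical_set_scope.
Local Open Scope ring_scope.

(** The point process Pi has law m on the space M of point measures, and L is
Lebesgue measure. Everything rests on one identity: since m is invariant under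
translations, the map (mu, u) |-> (theta (g u) mu, u) preserves m \x q for every
sigma-finite q on R^d and every measurable g ([distribution_skew]). It allows
one to move an inserted point from a random place u to the origin and back,
because theta x (mu + delta_u) = theta x mu + delta_(u + x).

Insertion tolerance implies absolute continuity with respect to the Palm
version ([insertion_tolerant_palm]). If the Palm version gives probability 0 to
A, the Palm formula over the unit cube Q says that almost surely Pi has no
point x in Q from which it looks like an element of A ([palm_null]). Insert an
independent uniform point U of Q: by insertion tolerance the result almost
surely has no such point either, and U itself is not one. Seen from U, the
process Pi + delta_U is distributed as Pi + delta_0, so the latter is almost
surely outside A.

Conversely ([palm_insertion_tolerant]), let A be null for Pi, and let A' be the
set of those mu such that theta u mu is in A for a set of u of positive
Lebesgue measure ([nonnull_orbit]). By Tonelli and invariance of m, A' is null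
for Pi; it is moreover translation-invariant, because L is, so the points from
which Pi looks like an element of A' are all or none of its points, and the
Palm formula makes A' null for the Palm version too
([nonnull_orbit_palm_null]). The hypothesis then gives that Pi + delta_0 is
almost surely outside A': almost surely, theta u (Pi + delta_0) is outside A
for Lebesgue-almost every u, hence for almost every value u of a variable U
uniform on S. By the skew identity, theta U (Pi + delta_0) has the
law of Pi + delta_U.

The probabilities of events such as [Pi + delta_U in A] are only meaningful
once these events are known to be measurable. All the measurability needed
follows from one statement, [measurable_measure_xsection]: for a measurable
family f t of point measures and a measurable C, the mass that f t gives to the
section of C at t depends measurably on t. *)

(** * Inserting a point in a point measure *)

Lemma counting_setU1 (T : choiceType) (R : realType) (x : T) (A : set T) :
  ~ A x -> counting (x |` A) = (counting A + 1)%E :> \bar R.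
Proof.
move=> nAx; rewrite /counting; have [fA|iA] := pselect (finite_set A).
  have fxA : finite_set (x |` A) by rewrite finite_setU; split.
  rewrite !asboolT// fset_setU// fset_set1 cardfsU1 in_fset_set//.
  by rewrite memNset// -EFinD natrD addrC.
rewrite !asboolF ?addye// => fxA; apply: iA.
by apply: sub_finite_set fxA; exact: subsetUr.
Qed.

Section point_measure_theory.
Variables (R : realType) (d : nat).
Local Notation E := 'rV[R]_d.
Local Notation M := (point_measure R d).
Local Open Scope ereal_scope.

Lemma point_measure_ext (mu nu : M) : (forall A, mu A = nu A) -> mu = nu.
Proof.
case: mu nu => [mu ? ?] [nu ? ?] /= mn.
have e : mu = nu by apply: eq_measure; apply/funext => A; exact: mn.
by subst nu; f_equal; exact: Prop_irrelevance.
Qed.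

Lemma measure_support (mu : M) (A : set E) :
  mu A = counting (A `&` Defs.support mu).
Proof.
case: (mu) => m [D mD] lf; rewrite [LHS]mD; congr (counting (A `&` _)).
apply/seteqP; split=> x; rewrite /Defs.support /= mD.
  move=> Dx; rewrite (_ : _ `&` _ = [set x]).
    by rewrite /counting asboolT// fset_set1 cardfs1.
  by apply/seteqP; split=> [y []//|y ->].
move=> /= h; apply: contrapT => nDx; move: h.
rewrite (_ : _ `&` _ = set0); last first.
  by apply/seteqP; split => // y [/= -> ?].
rewrite /counting asboolT// fset_set0 cardfs0 => -[] /eqP.
by rewrite eq_sym oner_eq0.
Qed.

Lemma measure_notin_support (mu : M) (x : E) :
  ~ Defs.support mu x -> mu [set x] = 0.
Proof.
move=> nx; rewrite measure_support (_ : _ `&` _ = set0).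
  by rewrite /counting asboolT// fset_set0 cardfs0.
by apply/seteqP; split => // y [/= -> ?].
Qed.

Lemma support_measure_neq0 (mu : M) (x : E) (B : set E) :
  Defs.support mu x -> B x -> mu B <> 0.
Proof.
move=> sx Bx; rewrite measure_support /counting.
case: asboolP => // fin [] /eqP; rewrite pnatr_eq0 cardfs_eq0 => /eqP.
by move/fset_set_set0 => /(_ fin) => e0; have : (B `&` Defs.support mu) x by [];
  rewrite e0.
Qed.

Section plus_point.
Variables (u : E) (mu : M).
Hypothesis u_notin : ~ Defs.support mu u.

Definition plus_point : {measure set E -> \bar R} :=
  measure_add mu (\d_u : {measure set E -> \bar R}).

Lemma plus_pointE A : plus_point A = mu A + \d_u A.
Proof. exact: measure_addE. Qed.

Lemma simple_plus_point : simple_point_measure plus_point.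
Proof.
exists (u |` Defs.support mu) => A; rewrite plus_pointE diracE measure_support.
rewrite setIUr; have [Au|nAu] := pselect (A u).
  rewrite mem_set// (_ : A `&` [set u] = [set u]).
    by rewrite counting_setU1// => -[].
  by apply/seteqP; split=> [y []//|y ->].
rewrite memNset// adde0 (_ : A `&` [set u] = set0) ?set0U//.
by apply/seteqP; split => // y [/[swap] /= ->].
Qed.

Lemma locally_finite_plus_point : locally_finite_measure plus_point.
Proof.
move=> A bA; rewrite plus_pointE lte_add_pinfty//.
  by case: (mu) bA => m _ /= /[apply].
by rewrite diracE ltry.
Qed.

End plus_point.

(** A total version of mu + delta_u: it leaves mu as it is when u is already one
of its points, where the sum would no longer be simple. *)
Definition insert_point (u : E) (mu : M) : M :=
  if pselect (Defs.support mu u) is right u_notin then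
    PointMeasure (simple_plus_point u_notin) (@locally_finite_plus_point u mu)
  else mu.

Lemma insert_pointE (u : E) (mu : M) A : mu [set u] = 0 ->
  insert_point u mu A = mu A + \d_u A.
Proof.
move=> mu0; rewrite /insert_point; case: pselect => [su|nu].
  by move: su; rewrite /Defs.support /= mu0 => -[] /eqP; rewrite eq_sym oner_eq0.
by rewrite /= plus_pointE.
Qed.

Lemma insert_point_id (u : E) (mu : M) : mu [set u] <> 0 ->
  insert_point u mu = mu.
Proof.
by rewrite /insert_point; case: pselect => // nu [];
  exact: measure_notin_support.
Qed.

(** This turns the event of [prec], which quantifies over point measures, into a
measurable condition on u and mu: if mu had an atom at u, the sum would have
mass 2 there and could not be a point measure. *)
Lemma sum_pointP (A : set M) (u : E) (mu : M) :
  (exists2 nu : M, A nu & (fun B => mu B + \d_u B) = nu) <->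
  mu [set u] = 0 /\ A (insert_point u mu).
Proof.
split=> [[nu Anu e]|[mu0 Amu]]; last first.
  by exists (insert_point u mu) => //; apply/funext => B; rewrite insert_pointE.
have mu0 : mu [set u] = 0.
  apply: measure_notin_support => su.
  have := congr1 (fun f => f [set u]) e; rewrite /= su diracE mem_set// => nu2.
  have [snu|nsnu] := pselect (Defs.support nu u).
    move: nu2; rewrite snu => -[] /eqP.
    by rewrite -subr_eq0 addrK oner_eq0.
  by move: nu2; rewrite (measure_notin_support nsnu) => -[] /eqP;
    rewrite -mulr2n pnatr_eq0.
split=> //; rewrite (_ : insert_point u mu = nu)//.
by apply: point_measure_ext => B; rewrite insert_pointE// -e.
Qed.

Lemma thetaE (x : E) (mu : M) A : theta x mu A = mu (translate x @^-1` A).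
Proof. by []. Qed.

Lemma theta0 (mu : M) : theta 0%R mu = mu.
Proof.
apply: point_measure_ext => A; rewrite thetaE; congr (mu _).
by apply/seteqP; split=> y; rewrite /preimage /translate /= addr0.
Qed.

Lemma thetaD (x y : E) (mu : M) : theta x (theta y mu) = theta (x + y)%R mu.
Proof.
apply: point_measure_ext => A; rewrite !thetaE; congr (mu _).
by apply/seteqP; split=> z; rewrite /preimage /translate /= (addrC x) addrA.
Qed.

Lemma theta_image (x : E) (A : set M) (mu : M) :
  (theta x @` A) mu <-> A (theta (- x)%R mu).
Proof.
split=> [[nu Anu <-]|Amu]; first by rewrite thetaD addNr theta0.
by exists (theta (- x)%R mu) => //; rewrite thetaD subrr theta0.
Qed.

Lemma theta_set1 (x u : E) (mu : M) :
  theta x mu [set u] = mu [set (u - x)%R].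
Proof.
rewrite thetaE; congr (mu _); apply/seteqP; split=> y; rewrite /translate /=.
  by move=> <-; rewrite addrK.
by move=> ->; rewrite subrK.
Qed.

Lemma theta_insert_point (x u : E) (mu : M) :
  theta x (insert_point u mu) = insert_point (u + x)%R (theta x mu).
Proof.
have [mu0|mu0] := pselect (mu [set u] = 0).
  apply: point_measure_ext => A; rewrite thetaE !insert_pointE//.
  by rewrite theta_set1 addrK.
by rewrite !insert_point_id// theta_set1 addrK.
Qed.

End point_measure_theory.

(** * Joint measurability in the point measure and the translation *)

Section measurability.
Variables (R : realType) (d : nat).
Local Notation E := 'rV[R]_d.
Local Notation M := (point_measure R d).
Local Open Scope ereal_scope.

Lemma measurable_evaluation (A : set E) : measurable A ->
  measurable_fun setT (fun mu : M => mu A).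
Proof.
move=> mA _ B mB; rewrite setTI; apply: sub_sigma_algebra.
by exists A => //; exists B => //; rewrite setTI.
Qed.

Lemma measurable_fun_point_measure d1 (T : measurableType d1) (f : T -> M) :
  (forall A : set E, measurable A -> measurable_fun setT (fun t => f t A)) ->
  measurable_fun setT f.
Proof.
move=> mf; apply: (measurability
  (\bigcup_(A in @measurable _ E) preimage_set_system setT
    (fun mu : M => mu A) measurable)) => //.
move=> _ [_ [A mA [B mB <-]] <-]; rewrite !setTI.
by rewrite -[X in measurable X]setTI; exact: mf.
Qed.

Section kernel.
Context d1 (T : measurableType d1) (f : T -> M) (mf : measurable_fun setT f).

Let k (t : T) : {measure set E -> \bar R} := f t.

Let measurable_k (A : set E) : measurable A -> measurable_fun setT (k ^~ A).
Proof. by move=> mA; exact: measurableT_comp (measurable_evaluation mA) mf. Qed.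

HB.instance Definition _ := isKernel.Build _ _ _ _ R k measurable_k.

(** A point measure is finite on every ball, though with no bound common to all
measures. For each ball D the map t |-> f t (C_t `&` D), with C_t the section of
C, is therefore measurable by a monotone class argument starting from
rectangles; letting D grow to the whole space gives the result. *)
Lemma measurable_measure_xsection (C : set (T * E)) : measurable C ->
  measurable_fun setT (fun t => f t (xsection C t)).
Proof.
move=> mC; pose D n : set E := ball (0%R : E) n.+1%:R.
have mD n : measurable (D n) by apply: open_measurable_rV; exact: ball_open.
have bD n : bounded_set (D n).
  exists n.+1%:R; split => // r nr x; rewrite /D -ball_normE /= sub0r normrN.
  by move=> /ltW /le_trans; apply; exact: ltW.
apply: (@emeasurable_fun_cvg _ _ _ _
  (fun n t => mrestr (k t) (mD n) (xsection C t))) => [n|t _].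
  have [|//] :=
    @measurable_prod_subset_xsection_kernel _ _ _ _ _ k _ (mD n) _ C mC.
  move=> t; exists (fine (f t (D n)) + 1)%R => X mX.
  have fn : f t (D n) \is a fin_num.
    rewrite ge0_fin_numE//; case: (f t) (bD n) => m _ /=; exact.
  rewrite EFinD fineK// (@le_lt_trans _ _ (f t (D n)))//.
    by rewrite /mrestr le_measure ?inE//; exact: measurableI.
  by rewrite lteDl// lte01.
have CE : xsection C t = \bigcup_n (xsection C t `&` D n).
  rewrite -setI_bigcupr (_ : \bigcup_n D n = setT) ?setIT//.
  apply/seteqP; split=> // x _; exists (Num.truncn `|x|) => //.
  by rewrite /D -ball_normE /= sub0r normrN truncnS_gt.
rewrite [X in _ --> f t X]CE.
have mI n : measurable (xsection C t `&` D n).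
  by apply: measurableI => //; exact: measurable_xsection.
apply: nondecreasing_cvg_mu => //; first exact: bigcupT_measurable.
move=> m n mn; apply/subsetPset; apply: setIS.
by apply: le_ball; rewrite ler_nat.
Qed.

End kernel.

Lemma measurable_fun_addrV d1 (T : measurableType d1) (f g : T -> E) :
  measurable_fun setT f -> measurable_fun setT g ->
  measurable_fun setT (fun t => f t + g t)%R.
Proof.
move=> mf mg; apply: measurable_fun_rV => i.
under eq_fun do rewrite mxE.
by apply: measurable_funD; exact: measurableT_comp (measurable_coord_rV i) _.
Qed.

Lemma measurable_opprV : measurable_fun setT (fun x : E => - x)%R.
Proof.
apply: measurable_fun_rV => i; under eq_fun do rewrite mxE.
apply: (@measurableT_comp _ _ _ _ _ _ (-%R : R -> R)) => //.
exact: measurable_coord_rV.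
Qed.

Lemma measurable_theta d1 (T : measurableType d1) (u : T -> E) (f : T -> M) :
  measurable_fun setT u -> measurable_fun setT f ->
  measurable_fun setT (fun t => theta (u t) (f t)).
Proof.
move=> mfu mf; apply: measurable_fun_point_measure => A mA.
(* theta (u t) (f t) A is the mass of {y | y + u t in A}, a section of h^-1 A *)
pose h (p : T * E) := (p.2 + u p.1)%R.
have mh : measurable_fun setT h.
  by apply: measurable_fun_addrV => //; exact: measurableT_comp mfu _.
have mC : measurable (h @^-1` A) by rewrite -[X in measurable X]setTI; exact: mh.
rewrite (_ : (fun t => _) = fun t => f t (xsection (h @^-1` A) t)).
  exact: measurable_measure_xsection.
by apply/funext => t; rewrite thetaE xsectionE.
Qed.

Lemma measurable_measure_set1 d1 (T : measurableType d1) (u : T -> E)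
    (f : T -> M) :
  measurable_fun setT u -> measurable_fun setT f ->
  measurable_fun setT (fun t => f t [set u t]).
Proof.
move=> mfu mf.
have m0 : measurable [set (0%R : E)].
  rewrite -(setCK [set 0%R]); apply: measurableC; apply: open_measurable_rV.
  rewrite openC; apply: accessible_closed_set1; apply: hausdorff_accessible.
  exact: norm_hausdorff.
have mt := measurable_theta (measurableT_comp measurable_opprV mfu) mf.
rewrite (_ : (fun t => _) = fun t => theta (- u t)%R (f t) [set 0%R]).
  exact: measurableT_comp (measurable_evaluation m0) mt.
by apply/funext => t; rewrite theta_set1 sub0r opprK.
Qed.

Lemma measurable_insert_point d1 (T : measurableType d1) (u : T -> E)
    (f : T -> M) :
  measurable_fun setT u -> measurable_fun setT f ->
  measurable_fun setT (fun t => insert_point (u t) (f t)).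
Proof.
move=> mfu mf; apply: measurable_fun_point_measure => A mA.
pose Z := [set t | f t [set u t] = 0].
have mZ : measurable Z.
  rewrite -[Z]setTI.
  exact: (measurable_measure_set1 mfu mf measurableT (emeasurable_set1 0)).
pose B := u @^-1` A.
have mB : measurable B by rewrite -[B]setTI; exact: mfu.
rewrite (_ : (fun t => _) = fun t => f t A + (\1_(Z `&` B) t)%:E).
  apply: emeasurable_funD.
    exact: measurableT_comp (measurable_evaluation mA) mf.
  by apply/measurable_EFinP; exact: measurable_indic (measurableI _ _ mZ mB).
apply/funext => t; rewrite indicE in_setI; have [Zt|nZt] := pselect (Z t).
  by rewrite insert_pointE// (mem_set Zt) diracE /=.
by rewrite insert_point_id// (memNset nZt) adde0.
Qed.

End measurability.

(** * Null sets and maps of product measures *)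

Section product_lemmas.
Local Open Scope ereal_scope.
Variable R : realType.

Lemma measurable_nonzero d1 (T : measurableType d1) (f : T -> \bar R) :
  measurable_fun setT f -> measurable [set x | f x <> 0].
Proof.
move=> mf.
rewrite (_ : [set x | _] = ~` (f @^-1` [set 0])) //; apply: measurableC.
rewrite -[X in measurable X]setTI.
exact: (mf measurableT _ (emeasurable_set1 0)).
Qed.

Lemma ge0_integral_eq0P d1 (T : measurableType d1)
    (mu : {measure set T -> \bar R}) (f : T -> \bar R) :
  measurable_fun setT f -> (forall x, 0 <= f x) ->
  \int[mu]_x f x = 0 <-> mu [set x | f x <> 0] = 0.
Proof.
move=> mf f0.
have -> : \int[mu]_x f x = \int[mu]_x `|f x|.
  by apply: eq_integral => x _; rewrite gee0_abs.
have mN := measurable_nonzero mf.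
rewrite (ae_eq_integral_abs _ measurableT mf).
rewrite -(negligibleP mu mN); split; apply: negligibleS => x /=.
  by move=> fx0 /(_ I).
by apply: contra_not => fx0 _.
Qed.

Section two_measures.
Context d1 d2 (T1 : measurableType d1) (T2 : measurableType d2).
Variable m1 : {sigma_finite_measure set T1 -> \bar R}.
Variable m2 : {sigma_finite_measure set T2 -> \bar R}.

Lemma product_measure_ysection (C : set (T1 * T2)) : measurable C ->
  (m1 \x m2) C = \int[m2]_y m1 (ysection C y).
Proof.
move=> mC; rewrite (@product_measure_unique _ _ _ _ _ m1 m2 (m1 \x^ m2))//.
by move=> A B mA mB /=; rewrite product_measure2E.
Qed.

Lemma product_measure_eq0P (C : set (T1 * T2)) : measurable C ->
  (m1 \x m2) C = 0 <-> m1 [set x | m2 (xsection C x) <> 0] = 0.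
Proof.
move=> mC; rewrite -(@ge0_integral_eq0P _ _ m1 (fun x => m2 (xsection C x)))//.
exact: measurable_fun_xsection.
Qed.

(** The map (x, y) |-> (h (x, y), y) preserves the product measure as soon as
each of its restrictions to a fiber of the second coordinate preserves m1:
integrate the sections over m2. *)
Lemma product_measure_skew (h : T1 * T2 -> T1) (K : set (T1 * T2)) :
  measurable_fun setT h -> measurable K ->
  (forall y A, measurable A -> m1 [set x | A (h (x, y))] = m1 A) ->
  (m1 \x m2) [set p | K (h p, p.2)] = (m1 \x m2) K.
Proof.
move=> mh mK hm.
have mhK : measurable [set p | K (h p, p.2)].
  rewrite -[X in measurable X]setTI.
  by apply: (measurable_fun_pair mh measurable_snd) => //.
rewrite !product_measure_ysection//; apply: eq_integral => y _.
rewrite -(hm y (ysection K y)); last exact: measurable_ysection.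
by congr (m1 _); apply/seteqP; split=> x; rewrite /ysection /= !inE.
Qed.

Lemma product_measure_map (f : T1 -> T1) (g : T2 -> T2) (C : set (T1 * T2)) :
  measurable_fun setT f -> measurable_fun setT g -> measurable C ->
  (forall A, measurable A -> m1 (f @^-1` A) = m1 A) ->
  (forall A, measurable A -> m2 (g @^-1` A) = m2 A) ->
  (m1 \x m2) [set p | C (f p.1, g p.2)] = (m1 \x m2) C.
Proof.
move=> mf mg mC fm gm; pose h p := (f p.1, g p.2).
have mh : measurable_fun setT h.
  by apply: measurable_fun_pair; apply: measurableT_comp.
pose H : {mfun _ >-> _} := HB.pack h (isMeasurableFun.Build _ _ _ _ _ mh).
rewrite [RHS](@product_measure_unique _ _ _ _ _ m1 m2
  (pushforward (m1 \x m2) H))//.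
move=> A B mA mB; rewrite -(fm A)// -(gm B)// -product_measure1E//.
- by rewrite -[X in measurable X]setTI; exact: mf.
- by rewrite -[X in measurable X]setTI; exact: mg.
Qed.

End two_measures.

Lemma lebesgue_measure_shift (c : R) (A : set R) :
  @measurable _ (measurableTypeR R) A ->
  @lebesgue_measure R ((fun a => a + c)%R @^-1` A) = lebesgue_measure A.
Proof.
move=> mA.
have ms : @measurable_fun _ _ (measurableTypeR R) (measurableTypeR R) setT
    (fun a : R => a + c)%R.
  by apply: (@measurable_funD _ (measurableTypeR R)) => //; exact: measurable_cst.
pose s : {mfun measurableTypeR R >-> measurableTypeR R} :=
  HB.pack (fun a : R => a + c)%R (isMeasurableFun.Build _ _ _ _ _ ms).
apply/esym/(@lebesgue_measure_unique _ (pushforward lebesgue_measure s)) => //.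
move=> _ [[a b]] _ <-; rewrite /pushforward.
transitivity (@lebesgue_measure R `](a - c)%R, (b - c)%R]%classic).
  by rewrite !lebesgue_measure_itv/= !lte_fin ltrD2r -!EFinB opprB addrA subrK.
congr lebesgue_measure.
by apply/seteqP; split=> x; rewrite /= !in_itv/= ltrBlDr lerBrDr.
Qed.

End product_lemmas.

(** * Lebesgue measure on R^d *)

Definition unit_cube (R : realType) (d : nat) : set 'rV[R]_d :=
  [set x | forall i, 0 <= x 0 i <= 1].
Arguments unit_cube : clear implicits.

Section lebesgue_rV_theory.
Local Open Scope ereal_scope.
Variable R : realType.

(** By induction on the dimension: through the decomposition into a first
coordinate and a tail, a translation is a product of two translations. *)
Lemma lebesgue_rV_translate d (x : 'rV[R]_d) (A : set 'rV[R]_d) :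
  measurable A -> lebesgue_rV R d (translate x @^-1` A) = lebesgue_rV R d A.
Proof.
elim: d x A => [x A _|d ih x A mA].
  congr (lebesgue_rV R 0 _); apply/seteqP; split=> y; rewrite /preimage /=.
    by rewrite (_ : translate x y = y)//; apply/rowP => -[].
  by rewrite (_ : translate x y = y)//; apply/rowP => -[].
rewrite /= /lebesgue_succ /pushforward.
pose x' : 'rV[R]_d := (\row_i x 0 (lift ord0 i))%R.
rewrite -[RHS](@product_measure_map _ _ _ _ _ _ _
  (fun a : measurableTypeR R => (a + x 0 ord0)%R : measurableTypeR R)
  (translate x')) //=.
- congr product_measure1; apply/seteqP; split=> -[a v]; rewrite /preimage /=.
    rewrite (_ : translate x _ = cons_rV (a + x 0 ord0, translate x' v))%R//.
    apply/rowP => i; rewrite /translate /cons_rV !mxE.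
    by case: unliftP => [j ->|->] /=; rewrite ?mxE.
  rewrite (_ : translate x _ = cons_rV (a + x 0 ord0, translate x' v))%R//.
  apply/rowP => i; rewrite /translate /cons_rV !mxE.
  by case: unliftP => [j ->|->] /=; rewrite ?mxE.
- by apply: (@measurable_funD _ (measurableTypeR R)) => //; exact: measurable_cst.
- exact: measurable_translate.
- by rewrite -[X in measurable X]setTI; exact: measurable_cons_rV.
- by move=> B mB; exact: lebesgue_measure_shift.
- by move=> B mB; exact: ih.
Qed.


Lemma measurable_unit_cube d : measurable (unit_cube R d).
Proof.
rewrite (_ : unit_cube R d = \bigcap_(i in [set: 'I_d])
    ((fun t : 'rV[R]_d => t 0%R i) @^-1` `[0%R, 1%R])).
  apply: fin_bigcap_measurable => // i _.
  by rewrite -[X in measurable X]setTI; apply: measurable_coord_rV.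
apply/seteqP; split => t /=.
  by move=> h i _; rewrite /= in_itv/=; exact: h.
by move=> h i; have := h i I; rewrite /= in_itv.
Qed.

Lemma lebesgue_unit_cube d : lebesgue_rV R d (unit_cube R d) = 1.
Proof.
elim: d => [|d ih]; first by rewrite /= diracE mem_set// => -[].
rewrite /= /lebesgue_succ /pushforward.
rewrite (_ : _ @^-1` _ = `[0%R, 1%R]%classic `*` unit_cube R d).
  rewrite product_measure1E//; last exact: measurable_unit_cube.
  by rewrite ih mule1 /= lebesgue_measure_itv/= lte01 oppr0 adde0.
apply/seteqP; split=> -[a v]; rewrite /preimage /cons_rV /unit_cube /=.
  move=> h; split; first by have := h ord0; rewrite mxE unlift_none in_itv.
  by move=> i; have := h (lift ord0 i); rewrite mxE liftK.
by move=> [a01 h] i; rewrite mxE; case: unliftP => [j _|_] /=;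
  [exact: h|move: a01; rewrite in_itv].
Qed.

(** The normalizing constant is 1, by [lebesgue_unit_cube]; normalizing makes
the restriction of Lebesgue measure a probability by construction. *)
Definition uniform_cube (d : nat) :=
  mnormalize (mrestr (lebesgue_rV R d) (@measurable_unit_cube d))
             (dirac (0 : 'rV[R]_d)%R).
Arguments uniform_cube : clear implicits.
HB.instance Definition _ (d : nat) := Probability.on (uniform_cube d).

Lemma uniform_cubeE (d : nat) (B : set 'rV[R]_d) :
  uniform_cube d B = lebesgue_rV R d (B `&` unit_cube R d).
Proof.
rewrite /uniform_cube /mnormalize /=.
have -> : mrestr (lebesgue_rV R d) (@measurable_unit_cube d) setT = 1.
  by rewrite /mrestr setTI lebesgue_unit_cube.
by rewrite onee_eq0 /= invr1 mule1.
Qed.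

End lebesgue_rV_theory.

Arguments uniform_cube : clear implicits.

(** * Palm version and translation orbits *)

Section palm.
Variables (R : realType) (d : nat).
Local Notation E := 'rV[R]_d.
Local Notation M := (point_measure R d).
Local Open Scope ereal_scope.

(** The Palm formula counts the points of mu in this set, which is defined for
all x rather than for the points of mu so that its measurability in mu is that
of a section. *)
Definition seen_from (A : set M) (S : set E) (mu : M) : set E :=
  S `&` [set x | A (theta (- x)%R mu)].

Lemma counting_seen_from (A : set M) (S : set E) (mu : M) :
  counting [set x | (Defs.support mu `&` S) x /\ (theta x @` A) mu] =
  mu (seen_from A S mu).
Proof.
rewrite measure_support; congr counting; apply/seteqP; split=> x /=.
  by move=> [[sx Sx] /theta_image Ax]; split.
by move=> [[Sx Ax] sx]; split=> //; apply/theta_image.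
Qed.

Lemma measurable_seen_from (A : set M) (S : set E) :
  measurable A -> measurable S ->
  measurable_fun setT (fun mu : M => mu (seen_from A S mu)).
Proof.
move=> mA mS.
pose h (p : M * E) := theta (- p.2)%R p.1.
have mh : measurable_fun setT h.
  apply: measurable_theta => //.
  exact: measurableT_comp (@measurable_opprV R d) measurable_snd.
pose C := (setT `*` S) `&` h @^-1` A.
have mC : measurable C.
  apply: measurableI; first exact: measurableX.
  by rewrite -[X in measurable X]setTI; exact: mh.
rewrite (_ : (fun mu => _) = fun mu : M => mu (xsection C mu)).
  exact: measurable_measure_xsection.
apply/funext => mu; congr (mu _); rewrite xsectionE.
by apply/seteqP; split=> x; rewrite /seen_from /C /h /=; tauto.
Qed.

Lemma measurable_sum_point_event d1 (T : measurableType d1) (u : T -> E)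
    (f : T -> M) (A : set M) :
  measurable_fun setT u -> measurable_fun setT f -> measurable A ->
  measurable [set t | f t [set u t] = 0 /\ A (insert_point (u t) (f t))].
Proof.
move=> mu mf mA; apply: measurableI.
  rewrite -[X in measurable X]setTI.
  exact: (measurable_measure_set1 mu mf measurableT (emeasurable_set1 0)).
by rewrite -[X in measurable X]setTI; exact: (measurable_insert_point mu mf).
Qed.

Lemma add_point_event d1 (T : measurableType d1) (P : probability T R)
    (Pi : {RV P >-> M}) (U : T -> E) (A : set M) :
  [set w | exists2 mu : M, A mu & add_point Pi U w = mu] =
  [set w | Pi w [set U w] = 0 /\ A (insert_point (U w) (Pi w))].
Proof. by apply/seteqP; split=> w /= /sum_pointP. Qed.

Lemma measurable_orbit (A : set M) : measurable A ->
  measurable [set p : M * E | A (theta p.2 p.1)].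
Proof.
move=> mA; rewrite -[X in measurable X]setTI.
by apply: (@measurable_theta R d _ (M * E)%type snd fst).
Qed.

Lemma xsection_orbit (A : set M) (mu : M) :
  xsection [set p : M * E | A (theta p.2 p.1)] mu = [set u | A (theta u mu)].
Proof. by apply/seteqP; split=> u; rewrite /xsection /= inE. Qed.

Lemma measurable_orbit_times (A : set M) (mu : M) : measurable A ->
  measurable [set u | A (theta u mu)].
Proof.
move=> mA; rewrite -(xsection_orbit A mu); apply: measurable_xsection.
exact: measurable_orbit.
Qed.

(** The translation-invariant set generated by A up to null sets of
translations. *)
Definition nonnull_orbit (A : set M) : set M :=
  [set mu | lebesgue_rV R d [set u | A (theta u mu)] <> 0].

Lemma measurable_nonnull_orbit (A : set M) :
  measurable A -> measurable (nonnull_orbit A).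
Proof.
move=> mA; have mO := measurable_orbit mA.
have := measurable_nonzero (measurable_fun_xsection (lebesgue_rV R d) mO).
by under eq_set do rewrite /= xsection_orbit.
Qed.

Lemma nonnull_orbit_theta (A : set M) (x : E) (mu : M) : measurable A ->
  nonnull_orbit A (theta x mu) <-> nonnull_orbit A mu.
Proof.
move=> mA; rewrite /nonnull_orbit /=.
have mO := measurable_orbit_times mu mA.
rewrite -(lebesgue_rV_translate x mO); split; apply: contra_not => <-;
  congr (lebesgue_rV R d _); apply/seteqP; split=> u;
  by rewrite /preimage /translate /= thetaD.
Qed.

(** * The two implications *)

Section palm_version.
Context d1 (T : measurableType d1) (P : probability T R) (Pi : {RV P >-> M}).
Context d2 (TS : measurableType d2) (PS : probability TS R)
  (PiS : {RV PS >-> M}).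
Hypothesis intensity_gt0 : 0 < intensity Pi.
Hypothesis palm : palm_version Pi PiS.

(** The Palm formula over the unit cube, read on null sets: the expected number
of points vanishes exactly when there is almost surely no point. *)
Lemma palm_null (A : set M) : measurable A ->
  PS [set w | A (PiS w)] = 0 <->
  P [set w | Pi w (seen_from A (unit_cube R d) (Pi w)) <> 0] = 0.
Proof.
move=> mA; have mQ := @measurable_unit_cube R d.
rewrite -(@ge0_integral_eq0P _ _ _ P
  (fun w => Pi w (seen_from A (unit_cube R d) (Pi w)))) //; last first.
  exact: measurableT_comp (measurable_seen_from mA mQ) _.
have -> : \int[P]_w Pi w (seen_from A (unit_cube R d) (Pi w)) =
    intensity Pi * PS [set w | A (PiS w)].
  rewrite -[intensity Pi]mule1 -(lebesgue_unit_cube R d) -palm//.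
    by apply: eq_integral => w _; rewrite counting_seen_from.
  by rewrite lebesgue_unit_cube ltry.
split=> [->|/eqP]; first by rewrite mule0.
by rewrite mule_eq0 gt_eqF//= => /eqP.
Qed.

Hypothesis inv : translation_invariant Pi.

Let m := distribution P Pi.

(** On the fiber over each u the map is the fixed translation by g u, which
preserves m. *)
Lemma distribution_skew (q : {sigma_finite_measure set E -> \bar R})
    (g : E -> E) (K : set (M * E)) :
  measurable_fun setT g -> measurable K ->
  (m \x q) [set p | K (theta (g p.2) p.1, p.2)] = (m \x q) K.
Proof.
move=> mg mK.
apply: (@product_measure_skew _ _ _ _ _ m q
  (fun p : M * E => theta (g p.2) p.1)) => //.
  by apply: measurable_theta => //; exact: measurableT_comp mg _.
by move=> u A mA; exact: (inv (g u) mA).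
Qed.

Lemma insertion_tolerant_palm : insertion_tolerant Pi ->
  prec P (add_point Pi (fun _ => 0%R)) PiS.
Proof.
move=> it A mA /(palm_null mA).
set Q := unit_cube R d; pose G := [set mu : M | mu (seen_from A Q mu) <> 0].
have mQ : measurable Q by exact: measurable_unit_cube.
have mG : measurable G by apply: measurable_nonzero; exact: measurable_seen_from.
move=> G0; rewrite add_point_event.
pose q : probability E R := uniform_cube R d.
pose Pi' : {RV (m \x q) >-> M} :=
  HB.pack (fst : M * E -> M)
    (isMeasurableFun.Build _ _ _ _ _ (@measurable_fst _ _ M E)).
pose U : {RV (m \x q) >-> E} :=
  HB.pack (snd : M * E -> E)
    (isMeasurableFun.Build _ _ _ _ _ (@measurable_snd _ _ M E)).
have fstE (B : set M) : measurable B -> (m \x q) [set p | B p.1] = m B.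
  move=> mB; rewrite (_ : [set p | _] = B `*` setT).
    rewrite product_measure1E// -[RHS]mule1; congr (_ * _).
    exact: probability_setT.
  by apply/seteqP; split=> p /=; tauto.
have sndE (B : set E) : measurable B -> (m \x q) [set p | B p.2] = q B.
  move=> mB; rewrite (_ : [set p | _] = setT `*` B).
    rewrite product_measure1E// -[RHS]mul1e; congr (_ * _).
    exact: probability_setT.
  by apply/seteqP; split=> p /=; tauto.
have LQ := @lebesgue_unit_cube R d.
have h := it Q mQ; rewrite LQ in h.
have {}h := h lte01 (ltry _) _ _ (m \x q) Pi' U.
have {h} : (m \x q) [set p | exists2 mu : M, G mu & add_point Pi' U p = mu] = 0.
  apply: h G0 => //.
  - by move=> B mB; rewrite LQ /= invr1 mule1 -uniform_cubeE; exact: sndE.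
  - move=> B C mB mC /=; rewrite fstE// sndE//.
    by rewrite -product_measure1E.
rewrite add_point_event => bad0.
pose H := [set nu : M | nu [set 0%R] = 0 /\ A (insert_point 0%R nu)].
have mH : measurable H by apply: measurable_sum_point_event.
(* by the skew identity, m H is the probability that theta (- U) Pi' lies in H,
   in which case Pi' + delta_U looks like an element of A from U *)
suff : m H = 0 by [].
have <- : (m \x q) [set p | (H `*` Q) (theta (- p.2)%R p.1, p.2)] = m H.
  rewrite (distribution_skew _ (@measurable_opprV R d))//; last exact: measurableX.
  rewrite product_measure1E// -[RHS]mule1; congr (_ * _).
  by rewrite [LHS]uniform_cubeE setIid LQ.
apply: (subset_measure0 _ _ _ bad0).
- rewrite -[X in measurable X]setTI.
  apply: (measurable_fun_pair _ measurable_snd) => //; last exact: measurableX.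
  apply: measurable_theta => //.
  exact: measurableT_comp (@measurable_opprV R d) measurable_snd.
- exact: measurable_sum_point_event.
move=> [mu u] [/= [mu0 Amu] Qu].
rewrite theta_set1 sub0r opprK in mu0.
split=> //=; rewrite /G /=.
have su : Defs.support (insert_point u mu) u.
  by rewrite /Defs.support /= insert_pointE// mu0 add0e diracE mem_set.
apply: (support_measure_neq0 su).
by split=> //=; rewrite theta_insert_point subrr.
Qed.

(** Tonelli: Lebesgue-almost no translation takes Pi into A, since each one
separately has probability 0 to do so. *)
Lemma nonnull_orbit_null (A : set M) : measurable A ->
  P [set w | A (Pi w)] = 0 -> P [set w | nonnull_orbit A (Pi w)] = 0.
Proof.
move=> mA A0; have mO := measurable_orbit mA.
have /(product_measure_eq0P m (lebesgue_rV R d) mO) :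
    (m \x lebesgue_rV R d) [set p | A (theta p.2 p.1)] = 0.
  have := @distribution_skew (lebesgue_rV R d) id (A `*` setT)
    (@measurable_id _ _ _).
  move=> /(_ (measurableX mA measurableT)).
  rewrite product_measure1E// [X in X * _](_ : _ = 0) ?mul0e//.
  move=> <-; congr (_ _); apply/seteqP; split=> p /=; tauto.
by under eq_set do rewrite xsection_orbit.
Qed.

(** A set that is null for Pi may have positive probability under the Palm
version (such as the set of measures with a point at 0), but not if it is
translation-invariant, as [nonnull_orbit A] is: then Pi looks like one of its
elements from some point only if Pi itself belongs to it. *)
Lemma nonnull_orbit_palm_null (A : set M) : measurable A ->
  P [set w | A (Pi w)] = 0 -> PS [set w | nonnull_orbit A (PiS w)] = 0.
Proof.
move=> mA A0; have mc := measurable_nonnull_orbit mA; apply/palm_null => //.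
have mPi : measurable_fun setT Pi by [].
apply: (subset_measure0 _ _ _ (nonnull_orbit_null mA A0)).
- apply: measurable_nonzero.
  have mQ := @measurable_unit_cube R d.
  exact: measurableT_comp (measurable_seen_from mc mQ) mPi.
- by rewrite -[X in measurable X]setTI; exact: mPi.
move=> w /= h; apply: contrapT => nc; apply: h.
rewrite (_ : seen_from _ _ _ = set0) ?measure0//.
by apply/seteqP; split=> // x [_ /=]; rewrite nonnull_orbit_theta.
Qed.

Section joint_law.
Context d3 (T' : measurableType d3) (P' : probability T' R).
Variables (Pi' : {RV P' >-> M}) (U : {RV P' >-> E}).
Hypotheses (law : same_law Pi' Pi) (ind : independent_RV Pi' U).

Lemma joint_law (C : set (M * E)) : measurable C ->
  P' [set w | C (Pi' w, U w)] = (m \x distribution P' U) C.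
Proof.
move=> mC; pose h w := (Pi' w, U w).
have mh : measurable_fun setT h by exact: measurable_fun_pair.
pose H : {RV P' >-> (M * E)%type} :=
  HB.pack h (isMeasurableFun.Build _ _ _ _ _ mh).
rewrite (@product_measure_unique _ _ _ _ _ m (distribution P' U)
  (distribution P' H))//.
by move=> A B mA mB; rewrite [LHS]ind// law.
Qed.

End joint_law.

Lemma palm_insertion_tolerant :
  prec P (add_point Pi (fun _ => 0%R)) PiS -> insertion_tolerant Pi.
Proof.
move=> pp S mS S0 Soo d3 T' P' Pi' U law unif ind A mA A0.
rewrite add_point_event.
have mc := measurable_nonnull_orbit mA.
have := pp _ mc (nonnull_orbit_palm_null mA A0); rewrite add_point_event => ins0.
(* the event Pi' + delta_U in A is that (theta (- U) Pi', U) belongs to K *)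
pose K := [set p : M * E | p.1 [set 0%R] = 0 /\
                           A (theta p.2 (insert_point 0%R p.1))].
have mK : measurable K.
  apply: measurableI.
    rewrite -[X in measurable X]setTI.
    exact: (measurable_measure_set1 (@measurable_cst _ _ _ _ _ _) measurable_fst
      measurableT (emeasurable_set1 0)).
  rewrite -[X in measurable X]setTI; apply: measurable_theta => //.
  by apply: measurable_insert_point.
pose q := distribution P' U.
have null_q (B : set E) : measurable B -> lebesgue_rV R d B = 0 -> q B = 0.
  move=> mB B0; rewrite [LHS]unif// (_ : lebesgue_rV R d _ = 0) ?mul0e//.
  apply: (subset_measure0 _ _ _ B0) => //; exact: measurableI.
have : (m \x q) K = 0.
  apply/(product_measure_eq0P m q mK).
  apply: (subset_measure0 _ _ _ ins0).
  - rewrite -[X in measurable X]setTI.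
    by have := measurable_nonzero (measurable_fun_xsection q mK);
      apply: measurable_funP.
  - by apply: measurable_sum_point_event.
  move=> w /=; move: (Pi w) => nu; rewrite xsectionE => qK.
  split.
    apply: contrapT => n0; apply: qK.
    rewrite (_ : _ @^-1` _ = set0) ?measure0//.
    by apply/seteqP; split=> // u [].
  rewrite /nonnull_orbit /=; apply: contra_not qK.
  move=> /(null_q _ (measurable_orbit_times _ mA)) qO.
  apply: (subset_measure0 _ _ _ qO) => [|| u []//].
    by rewrite -xsectionE; exact: measurable_xsection.
  exact: measurable_orbit_times.
rewrite -(distribution_skew q (@measurable_opprV R d) mK) -(joint_law law ind)//.
- apply: etrans; congr (P' _); apply/seteqP; split=> w; rewrite /K /=;
  by rewrite theta_set1 theta_insert_point thetaD sub0r opprK add0r subrr theta0.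
- rewrite -[X in measurable X]setTI.
  apply: (measurable_fun_pair _ measurable_snd) => //.
  apply: measurable_theta => //.
  exact: measurableT_comp (@measurable_opprV R d) measurable_snd.
Qed.

End palm_version.
End palm.

Theorem theorem4 (R : realType) (d : nat) (d_gt0 : (0 < d)%N)
    (disp : measure_display) (T : measurableType disp) (P : probability T R)
    (Pi : {RV P >-> point_measure R d})
    (dispS : measure_display) (TS : measurableType dispS)
    (PS : probability TS R) (PiS : {RV PS >-> point_measure R d}) :
  translation_invariant Pi -> ergodic Pi ->
  (0 < intensity Pi)%E -> (intensity Pi < +oo)%E ->
  palm_version Pi PiS ->
  (insertion_tolerant Pi <->
   prec P (add_point Pi (fun _ => 0%R)) PiS).
Proof.
move=> inv _ intensity_gt0 _ palm; split.
  exact: insertion_tolerant_palm.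
exact: palm_insertion_tolerant.
Qed.
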